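(* Let $g=(g_n)_{n\in\mathbb{Z}_d}$ be a unit vector in $\mathbb{C}^d$. The following statements hold. (i) $G(g)$ is a block circulant matrix with circulant blocks (the blocks being indexed by $(k,k')$, and the entries within a block by $(\ell,\ell')$). In particular, for $k,k',\ell,\ell'\in\{0,\dots,d-1\}$, the $((k,\ell),(k',\ell'))$-entry of $G(g)$ is $$\langle\Pi_{k,\ell},\Pi_{k',\ell'}\rangle_{HS}=|\langle g,M^{k'-k}T^{\ell'-\ell}g\rangle|^2 .$$ (ii) $G(g)$ can be diagonalized by $F\otimes F$. In particular, the eigenvalues $\{\lambda_{a,b}\}_{a,b\in\mathbb{Z}_d}$ of $G(g)$ (with multiplicity) are given by $$\lambda_{a,b}=\sum_{k,\ell=0}^{d-1}\omega^{ak-b\ell}\,|\langle g,M^kT^\ell g\rangle|^2=d\left|\sum_{k=0}^{d-1}g_k\overline{g_{k+a}}\,\omega^{bk}\right|^2=d\,|\langle g,M^bT^ag\rangle|^2,\qquad a,b\in\mathbb{Z}_d .$$ In particular, up to a factor of $d$, the entries of $G(g)$ are the same as its eigenvalues.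
   Context: Vectors in $\mathbb{C}^d$ are indexed by $\mathbb{Z}_d=\{0,\dots,d-1\}$ (indices mod $d$), $\omega=e^{2\pi i/d}$, and $\langle x,y\rangle=\sum_n x_n\overline{y_n}$. The modulation and translation operators are $(Mg)_n=\omega^ng_n$ and $(Tg)_n=g_{n-1}$. For $(k,\ell)\in\mathbb{Z}_d\times\mathbb{Z}_d$ let $\Pi_{k,\ell}=(M^kT^\ell g)(M^kT^\ell g)^*$, and let $\langle A,B\rangle_{HS}=\mathrm{tr}(AB^* )$. The Gram matrix is the $d^2\times d^2$ matrix $G(g)=(\langle\Pi_{k,\ell},\Pi_{k',\ell'}\rangle_{HS})$, rows and columns being ordered lexicographically by $(k,\ell)$. $F$ is the $d\times d$ DFT matrix with entries $F_{k,\ell}=\omega^{k\ell}/\sqrt d$; that $G(g)$ is diagonalized by $F\otimes F$ means that the columns of $F\otimes F$ are eigenvectors of $G(g)$. A matrix is circulant (resp. block circulant) if its entries (resp. blocks) depend only on the difference of the column and row indices modulo $d$. *)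

(* Defs.v *)
From HB Require Import structures.
From mathcomp Require Import all_boot all_order all_algebra.
From mathcomp Require Import all_classical all_reals all_analysis.
From mathcomp Require Export complex mxtens.

Set Implicit Arguments.
Unset Strict Implicit.
Unset Printing Implicit Defensive.

Import Order.TTheory GRing.Theory Num.Theory.
Local Open Scope ring_scope.

(* The dimension is n.+1: a unit vector forces it to be positive, and 'I_n.+1
   is the additive group Z/(n.+1), including for n = 0. Hence sums and
   differences of indices below are taken modulo the dimension. *)

Definition omega (R : realType) (d : nat) : R[i] :=
  Complex (cos (2 * pi / d%:R)) (sin (2 * pi / d%:R)).

Section TimeFrequency.
Variables (R : realType) (n : nat).
Implicit Types (x y g : 'cV[R[i]]_n.+1) (k l : 'I_n.+1).

(* Linear in the first argument, conjugate-linear in the second. *)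
Definition inner x y : R[i] := \sum_m x m 0 * (y m 0)^*.

Definition vnorm x : R[i] := sqrtC (inner x x).

Definition modulation g : 'cV[R[i]]_n.+1 :=
  \col_m (omega R n.+1 ^+ m * g m 0).

(* inZp 1 is the class of 1 modulo n.+1; 'I_n.+1 has no 1 when n = 0. *)
Definition translation g : 'cV[R[i]]_n.+1 := \col_m g (m - inZp 1) 0.

(* M^k T^l g; as M and T have order dividing n.+1, taking exponents in
   {0, ..., n} is no restriction, and M^(k' - k) T^(l' - l) g is
   tfshift (k' - k) (l' - l) g. *)
Definition tfshift k l g : 'cV[R[i]]_n.+1 :=
  iter k modulation (iter l translation g).

Definition adjointmx p q (A : 'M[R[i]]_(p, q)) : 'M[R[i]]_(q, p) :=
  map_mx Num.conj A^T.

Definition Proj g k l : 'M[R[i]]_n.+1 :=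
  tfshift k l g *m adjointmx (tfshift k l g).

Definition inner_HS (A B : 'M[R[i]]_n.+1) : R[i] := \tr (A *m adjointmx B).

(* mxtens_index (k, l) = k * n.+1 + l is the lexicographic rank of (k, l). *)
Definition Gram g : 'M[R[i]]_(n.+1 * n.+1) :=
  \matrix_(i, j)
    inner_HS (Proj g (mxtens_unindex i).1 (mxtens_unindex i).2)
             (Proj g (mxtens_unindex j).1 (mxtens_unindex j).2).

Definition DFT : 'M[R[i]]_n.+1 :=
  \matrix_(k, l) (omega R n.+1 ^+ (k * l)%N / sqrtC n.+1%:R).

End TimeFrequency.

Arguments DFT : clear implicits.

Definition circulant (T : Type) (n : nat) (A : 'M[T]_n.+1) : Prop :=
  exists c : 'I_n.+1 -> T, forall i j, A i j = c (j - i).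

Definition mxblk (T : Type) (n : nat) (A : 'M[T]_(n.+1 * n.+1))
    (k k' : 'I_n.+1) : 'M[T]_n.+1 :=
  \matrix_(l, l') A (mxtens_index (k, l)) (mxtens_index (k', l')).

Definition block_circulant (T : Type) (n : nat) (A : 'M[T]_(n.+1 * n.+1)) :
    Prop :=
  exists B : 'I_n.+1 -> 'M[T]_n.+1, forall k k', mxblk A k k' = B (k' - k).

(* Right eigenvectors, whereas mxalgebra's eigenspace has row vectors. *)
Definition eigenvector (F : fieldType) (m : nat) (A : 'M[F]_m) (v : 'cV[F]_m) :
    Prop :=
  v != 0 /\ exists mu : F, A *m v = mu *: v.

Definition diagonalized_by (F : fieldType) (m : nat) (A P : 'M[F]_m) : Prop :=
  forall j, eigenvector A (col j P).

(* Main.v *)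
Require Import Defs.
From mathcomp Require Import all_boot all_order all_algebra.
From mathcomp Require Import all_classical all_reals all_analysis.
From mathcomp Require Import ring.

(** The entry of the Gram matrix at ((k, l), (k', l')) is the squared modulus
    of the inner product of two time-frequency shifts of g (rank-one trace
    formula), and M, T commute up to phases, so it depends only on the
    differences: it is the function [ambiguity2 g] at (k' - k, l' - l)
    ([inner_HS_Proj]).  This is part (i).

    A matrix whose entries depend only on these differences acts as a
    convolution on the group Z/d x Z/d, and is therefore diagonalized by the
    characters of that group, the columns of the tensor square of the DFT
    matrix; its eigenvalues are the Fourier coefficients of the function
    ([mulmx_circulant_DFT], [char_poly_two_level_circulant]).

    What is special to the Gram matrix is that [ambiguity2 g] is, up to the
    factor d and a swap of the two variables, its own (symplectic) Fourier
    transform ([ambiguity2_self_dual]).  Indeed, summing over the modulations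
    with orthogonality of characters yields the autocorrelation of the sequence
    m |-> g_m (g_(m+a))^* ([ambiguity2_sum_modulations]); the Fourier transform
    of an autocorrelation is the squared modulus of the Fourier transform of
    the sequence ([ambiguity2_fourier]), which is again a value of the
    ambiguity function, with phase and conjugation lost in the modulus
    ([lag_fourier_norm]).

    The characters are handled through the pairing (k, l) |-> omega^(k l);
    only its additivity in each argument, its values of modulus one and the
    orthogonality relation [pairing_sum] are used. *)

Set Implicit Arguments.
Unset Strict Implicit.
Unset Printing Implicit Defensive.

Import Order.TTheory GRing.Theory Num.Theory.
Local Open Scope ring_scope.

(** * The root of unity *)

Section RootOfUnity.
Variable R : realType.

Lemma omega_expr (d m : nat) :
  omega R d ^+ m
    = Complex (cos (2 * pi / d%:R *+ m)) (sin (2 * pi / d%:R *+ m)).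
Proof.
elim: m => [|m IHm]; first by rewrite expr0 mulr0n cos0 sin0.
rewrite exprS IHm (mulrS (_ / _)) cosD sinD /omega; apply/eqP.
by rewrite eq_complex /= eqxx /= addrC.
Qed.

Lemma cos_double_neq1 (y : R) : 0 < y < pi -> cos (y *+ 2) != 1.
Proof.
move=> /sin_gt0_pi sin_gt0; rewrite cos_mulr2n cos2sin2.
by rewrite lt_eqF// ltrBlDr -[1 + 1]mulr2n ltrMn2r /= gtrBl exprn_gt0.
Qed.

(** omega^m = 1 forces cos (2 pi m / d) = 1, which is impossible for
    0 < m < d since m pi / d then lies strictly between 0 and pi, where the
    sine does not vanish. *)
Lemma omega_primitive (d : nat) :
  (0 < d)%N -> d.-primitive_root (omega R d).
Proof.
move=> d_gt0; have dR : d%:R != 0 :> R by rewrite pnatr_eq0 -lt0n.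
rewrite /primitive_root_of_unity d_gt0 /=; apply/forallP => i.
rewrite unity_rootE omega_expr eq_complex /=.
have [->|neq_id] := eqVneq i.+1 d.
  by rewrite -mulr_natr mulfVK// mulr_natl cos2pi sin2pi !eqxx.
set y : R := pi / d%:R *+ i.+1.
have -> : 2 * pi / d%:R *+ i.+1 = y *+ 2 :> R.
  by rewrite -mulrA -mulr_natl /y mulrCA mulr_natl mulr_natl.
have y_itv : 0 < y < pi.
  rewrite /y -mulr_natr mulr_gt0 ?divr_gt0 ?pi_gt0 ?ltr0n//=.
  rewrite mulrAC ltr_pdivrMr ?ltr0n// ltr_pM2l ?pi_gt0// ltr_nat.
  by rewrite ltn_neqAle neq_id ltn_ord.
by rewrite (negbTE (cos_double_neq1 y_itv)).
Qed.

End RootOfUnity.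

(** * The pairing of Z/(n+1) with itself *)

Section Pairing.
Variables (R : realType) (n : nat).
Implicit Types a b k l m : 'I_n.+1.
Local Notation w := (omega R n.+1).

(** The product of representatives is taken in nat: 'I_n.+1 has no ring
    structure for n = 0, and omega^(n+1) = 1 makes the choice immaterial. *)
Definition pairing k l : R[i] := w ^+ (k * l)%N.

Let w_prim : n.+1.-primitive_root w := omega_primitive R (ltn0Sn n).

Lemma pairingC k l : pairing k l = pairing l k.
Proof. by rewrite /pairing mulnC. Qed.

Lemma pairingDr k l m : pairing k (l + m) = pairing k l * pairing k m.
Proof.
rewrite /pairing -exprD -mulnDr -(prim_expr_mod w_prim) /=.
by rewrite modnMmr (prim_expr_mod w_prim).
Qed.

Lemma pairing0r k : pairing k 0 = 1.
Proof. by rewrite /pairing muln0 expr0. Qed.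

Lemma pairing_norm k l : `|pairing k l| = 1.
Proof.
apply/eqP; rewrite -(@pexpr_eq1 _ _ n.+1)// -normrX /pairing exprAC.
by rewrite (prim_expr_order w_prim) expr1n normr1.
Qed.

Lemma pairing_conj_mul k l : pairing k l * (pairing k l)^* = 1.
Proof. by rewrite -normCK pairing_norm expr1n. Qed.

Lemma pairing_neq0 k l : pairing k l != 0.
Proof. by rewrite -normr_eq0 pairing_norm oner_eq0. Qed.

Lemma pairingNr k l : pairing k (- l) = (pairing k l)^*.
Proof.
apply: (mulfI (pairing_neq0 k l)).
by rewrite -pairingDr subrr pairing0r pairing_conj_mul.
Qed.

Lemma pairingDl k l m : pairing (k + l) m = pairing k m * pairing l m.
Proof. by rewrite pairingC pairingDr !(pairingC m). Qed.

Lemma pairingNl k l : pairing (- k) l = (pairing k l)^*.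
Proof. by rewrite pairingC pairingNr pairingC. Qed.

(** Orthogonality of characters: for k != 0 this is a geometric series of ratio
    omega^k != 1 whose ratio has (n+1)-st power 1. *)
Lemma pairing_sum k : \sum_l pairing k l = n.+1%:R *+ (k == 0).
Proof.
have [->|k_neq0] := eqVneq k 0.
  rewrite (eq_bigr (fun=> 1)) => [|l _]; last by rewrite pairingC pairing0r.
  by rewrite sumr_const card_ord.
have wk_neq1 : w ^+ k - 1 != 0.
  rewrite subr_eq0 -(prim_order_dvd w_prim).
  apply: contra k_neq0 => /dvdnP[[|q] kE]; first exact/eqP/val_inj.
  by have := ltn_ord k; rewrite kE mulSn ltnNge leq_addr.
apply: (mulfI wk_neq1); rewrite mulr0n mulr0.
rewrite (eq_bigr (fun l : 'I_n.+1 => (w ^+ k) ^+ l)) => [|l _].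
  by rewrite -subrX1 exprAC (prim_expr_order w_prim) expr1n subrr.
by rewrite /pairing exprM.
Qed.

(** The exponent a k - b l is a possibly negative integer, not a class modulo
    n+1; this brings it back to the pairing. *)
Lemma omega_exprB k l a b :
  w ^ ((a * k)%N%:Z - (b * l)%N%:Z) = pairing a k * (pairing b l)^*.
Proof.
have w_neq0 : w != 0 by rewrite (prim_root_eq0 w_prim).
rewrite expfzDr//; congr (_ * _).
apply: (mulfI (pairing_neq0 b l)); rewrite pairing_conj_mul /pairing.
by rewrite (exprnP w (b * l)) -expfzDr// subrr expr0z.
Qed.

Lemma DFT_E k l : DFT R n k l = pairing k l / sqrtC n.+1%:R.
Proof. by rewrite mxE. Qed.

(** By orthogonality the DFT matrix is unitary, so its adjoint is an inverse. *)
Lemma DFT_unit : DFT R n \in unitmx.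
Proof.
suff : DFT R n *m adjointmx (DFT R n) = 1%:M by case/mulmx1_unit.
apply/matrixP => k l; rewrite mxE.
have sqrt_norm2 : sqrtC n.+1%:R * (sqrtC n.+1%:R)^* = n.+1%:R :> R[i].
  by rewrite -normCK ger0_norm ?sqrtC_ge0 ?ler0n// sqrtCK.
rewrite (eq_bigr (fun m => pairing (k - l) m / n.+1%:R)) => [|m _].
  rewrite -mulr_suml pairing_sum subr_eq0 mxE.
  by case: eqP => _; rewrite ?mul0r// mulr1n divff// pnatr_eq0.
rewrite !mxE -/(pairing k m) -/(pairing l m) rmorphM /= fmorphV /=.
by rewrite mulrACA -invfM sqrt_norm2 pairingDl pairingNl.
Qed.

End Pairing.

(** * Inner products of time-frequency shifts *)

Section TimeFrequencyShifts.
Variables (R : realType) (n : nat) (g : 'cV[R[i]]_n.+1).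
Implicit Types (k l m a b : 'I_n.+1) (x y : 'cV[R[i]]_n.+1).
Local Notation e := (@pairing R n).

Lemma tfshiftE k l m : tfshift k l g m 0 = e k m * g (m - l) 0.
Proof.
have translationE : forall (j : nat) m,
    iter j (@translation R n) g m 0 = g (m - inZp 1 *+ j) 0.
  elim=> [|j IHj] {}m; first by rewrite mulr0n subr0.
  by rewrite iterS mxE IHj mulrS opprD addrA.
have one_gen : inZp 1 *+ l = l.
  by apply/val_inj; rewrite Zp_mulrn /= modnMml mul1n modn_small.
have modulationE : forall (j : nat) x,
    iter j (@modulation R n) x m 0 = omega R n.+1 ^+ (j * m)%N * x m 0.
  elim=> [|j IHj] x; first by rewrite mul0n expr0 mul1r.
  by rewrite iterS mxE IHj mulrA -exprD mulSn.
by rewrite /tfshift modulationE translationE one_gen.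
Qed.

(** By cyclicity of the trace, tr (x x' y y') = (x' y) (y' x), where the primes
    denote adjoints. *)
Lemma inner_HS_rank1 x y :
  inner_HS (x *m adjointmx x) (y *m adjointmx y) = `|inner x y| ^+ 2.
Proof.
rewrite normCK /inner rmorph_sum /= big_distrlr /= /inner_HS /mxtrace.
apply: eq_bigr => i _; rewrite mxE; apply: eq_bigr => j _.
rewrite !mxE !big_ord1 !mxE !rmorphM /= !conjCK.
by rewrite mulrACA.
Qed.

(** Translating the summation index by l moves the first shift to the second
    argument; commuting M with T on the way only produces a phase. *)
Lemma inner_tfshift k l k' l' :
  inner (tfshift k l g) (tfshift k' l' g)
    = (e (k' - k) l)^* * inner g (tfshift (k' - k) (l' - l) g).
Proof.
rewrite /inner (reindex_inj (addIr l)) /= mulr_sumr.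
apply: eq_bigr => m _.
rewrite !tfshiftE addrK (_ : m - (l' - l) = m + l - l'); last first.
  by rewrite opprB addrA.
by rewrite !pairingDr !pairingDl !pairingNl !rmorphM /= !conjCK; ring.
Qed.

(** The squared modulus of the discrete ambiguity function of g. *)
Definition ambiguity2 k l : R[i] := `|inner g (tfshift k l g)| ^+ 2.

Lemma inner_HS_Proj k l k' l' :
  inner_HS (Proj g k l) (Proj g k' l') = ambiguity2 (k' - k) (l' - l).
Proof.
by rewrite inner_HS_rank1 inner_tfshift normrM norm_conjC pairing_norm mul1r.
Qed.

Lemma GramE k l k' l' :
  Gram g (mxtens_index (k, l)) (mxtens_index (k', l'))
    = ambiguity2 (k' - k) (l' - l).
Proof. by rewrite mxE !mxtens_indexK inner_HS_Proj. Qed.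

(** For fixed a, the Fourier transform of this sequence in m gives, up to phase
    and conjugation, the inner products of g with the M^b T^a g. *)
Definition lag a m : R[i] := g m 0 * (g (m + a) 0)^*.

(** Expanding the squared modulus gives a double sum over m and m'; summing the
    phases over k keeps only the terms with m = m' + a. *)
Lemma ambiguity2_sum_modulations a l :
  \sum_k e a k * ambiguity2 k l
    = n.+1%:R * \sum_m (lag a m)^* * lag a (m - l).
Proof.
pose h m := g m 0 * (g (m - l) 0)^*.
have innerE k : inner g (tfshift k l g) = \sum_m (e k m)^* * h m.
  apply: eq_bigr => m _; rewrite tfshiftE rmorphM /= mulrCA; congr (_ * _).
transitivity (\sum_m \sum_m' (h m * (h m')^*) * \sum_k e (a - m + m') k).
  under eq_bigr => k _.
    rewrite /ambiguity2 normCK innerE rmorph_sum /= big_distrlr /= mulr_sumr.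
    under eq_bigr do rewrite mulr_sumr.
    over.
  rewrite exchange_big /=; apply: eq_bigr => m _.
  rewrite exchange_big /=; apply: eq_bigr => m' _.
  rewrite mulr_sumr; apply: eq_bigr => k _.
  rewrite rmorphM /= conjCK mulrACA (mulrA (e a k)) mulrC; congr (_ * _).
  by rewrite !pairingDl pairingNl mulrA !(pairingC _ k).
rewrite exchange_big /= mulr_sumr; apply: eq_bigr => m' _.
rewrite (bigD1 (m' + a)) //= [X in _ + X]big1 ?addr0 => [|m neq_m]; last first.
  rewrite pairing_sum (_ : _ == 0 = false) ?mulr0n ?mulr0//.
  by apply: contraNF neq_m; rewrite addrAC subr_eq0 addrC eq_sym.
have -> : a - (m' + a) + m' = 0 by rewrite opprD addrCA subrr addr0 addNr.
rewrite pairing_sum eqxx mulr1n mulrC; congr (_ * _).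
by rewrite /h /lag !rmorphM /= !conjCK [m' + a - l]addrAC; ring.
Qed.

(** The Wiener-Khinchin principle for the autocorrelation of [lag a]: the
    substitution l = m - m' turns its Fourier transform into a product of two
    conjugate sums. *)
Lemma ambiguity2_fourier a b :
  \sum_k \sum_l e a k * (e b l)^* * ambiguity2 k l
    = n.+1%:R * `|\sum_m lag a m * e b m| ^+ 2.
Proof.
rewrite exchange_big /=.
transitivity (\sum_l n.+1%:R
    * \sum_m (e b l)^* * ((lag a m)^* * lag a (m - l))).
  apply: eq_bigr => l _; rewrite -mulr_sumr mulrCA -ambiguity2_sum_modulations.
  by rewrite mulr_sumr; apply: eq_bigr => k _; ring.
rewrite -mulr_sumr; congr (_ * _).
rewrite normCK mulrC rmorph_sum big_distrlr exchange_big /=.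
apply: eq_bigr => m _; rewrite (reindex_inj (@subrI _ m)) /=.
apply: eq_bigr => m' _; rewrite subKr pairingDr pairingNr.
by rewrite !rmorphM /= conjCK; ring.
Qed.

Lemma lag_fourier_norm a b :
  `|\sum_m lag a m * e b m| = `|inner g (tfshift b a g)|.
Proof.
suff -> : inner g (tfshift b a g) = (e b a)^* * (\sum_m lag a m * e b m)^*.
  by rewrite normrM !norm_conjC pairing_norm mul1r.
rewrite rmorph_sum mulr_sumr /inner (reindex_inj (addIr a)) /=.
apply: eq_bigr => m _.
by rewrite tfshiftE addrK pairingDr /lag !rmorphM /= conjCK; ring.
Qed.

(** The reason why the eigenvalues of the Gram matrix are, up to the factor
    n+1, its entries. *)
Lemma ambiguity2_self_dual a b :
  \sum_k \sum_l e a k * (e b l)^* * ambiguity2 k l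
    = n.+1%:R * ambiguity2 b a.
Proof. by rewrite ambiguity2_fourier lag_fourier_norm. Qed.

End TimeFrequencyShifts.

(** * Diagonalizing two-level circulant matrices *)

(** The relation A P = P D passes to the characteristic matrices, and the
    determinant of P cancels. *)
Lemma char_poly_similar_diag (F : fieldType) (m : nat) (A P : 'M[F]_m)
    (d : 'rV[F]_m) :
  P \in unitmx -> A *m P = P *m diag_mx d ->
  char_poly A = \prod_j ('X - (d 0 j)%:P).
Proof.
move=> Pu AP; set PX := map_mx polyC P.
have APX : char_poly_mx A *m PX = PX *m char_poly_mx (diag_mx d).
  rewrite /char_poly_mx mulmxBl mulmxBr -!map_mxM AP; congr (_ - _).
  by rewrite mul_scalar_mx mul_mx_scalar.
have detPX : \det PX != 0 by rewrite det_map_mx polyC_eq0 -unitfE -unitmxE.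
rewrite /char_poly; apply: (mulIf detPX).
rewrite -det_mulmx APX det_mulmx mulrC; congr (_ * _).
rewrite -/(char_poly _) char_poly_trig ?diag_mx_is_trig//.
by apply: eq_bigr => j _; rewrite mxE eqxx mulr1n.
Qed.

(** A zero column of P would make a column of (P^-1) P = 1 vanish. *)
Lemma diagonalized_by_unit (F : fieldType) (m : nat) (A P : 'M[F]_m)
    (d : 'rV[F]_m) :
  P \in unitmx -> A *m P = P *m diag_mx d -> diagonalized_by A P.
Proof.
move=> Pu AP j; split; last first.
  exists (d 0 j); rewrite colE mulmxA AP -!colE; apply/matrixP => i z.
  by rewrite mul_mx_diag !mxE mulrC.
apply/eqP => colP0; have := mulVmx Pu => /(congr1 (fun B => col j B)).
rewrite colE -mulmxA -colE colP0 mulmx0 => /matrixP/(_ j 0)/eqP.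
by rewrite !mxE eqxx eq_sym oner_eq0.
Qed.

Lemma big_mxtens (T : Type) (idx : T) (op : Monoid.com_law idx) (p q : nat)
    (F : 'I_(p * q) -> T) :
  \big[op/idx]_i F i
    = \big[op/idx]_(i < p) \big[op/idx]_(j < q) F (mxtens_index (i, j)).
Proof.
rewrite pair_big (reindex (@mxtens_index p q)) /=.
  by apply: eq_bigr => -[].
by exists (@mxtens_unindex p q) => i _; rewrite (mxtens_indexK, mxtens_unindexK).
Qed.

Section TwoLevelCirculant.
Variables (R : realType) (n : nat) (f : 'I_n.+1 -> 'I_n.+1 -> R[i]).
Variable A : 'M[R[i]]_(n.+1 * n.+1).
Hypothesis AE : forall k l k' l',
  A (mxtens_index (k, l)) (mxtens_index (k', l')) = f (k' - k) (l' - l).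
Local Notation e := (@pairing R n).

(** Row (k, l) of the product is a convolution sum: substituting
    (k' + k, l' + l) for (k', l') factors the character value at (k, l) out. *)
Lemma mulmx_circulant_DFT :
  A *m (DFT R n *t DFT R n) = (DFT R n *t DFT R n)
    *m diag_mx (\row_j \sum_k \sum_l e (mxtens_unindex j).1 k
                                     * e (mxtens_unindex j).2 l * f k l).
Proof.
apply/matrixP => i j; rewrite mul_mx_diag.
case: (mxtens_indexP i) => k l; case: (mxtens_indexP j) => a b.
rewrite [LHS]mxE [RHS]mxE tensmxE [X in _ = _ * X]mxE mxtens_indexK /=.
rewrite big_mxtens mulr_sumr (reindex_inj (addIr k)) /=.
apply: eq_bigr => k' _; rewrite mulr_sumr (reindex_inj (addIr l)) /=.
apply: eq_bigr => l' _; rewrite AE !addrK tensmxE !DFT_E.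
rewrite !pairingDl !(pairingC _ a) !(pairingC _ b); ring.
Qed.

Lemma DFT2_unit : DFT R n *t DFT R n \in unitmx.
Proof. by rewrite tensmx_unit ?DFT_unit. Qed.

(** The columns of the tensor square are indexed by (a, b) with character
    e a k * e b l; the change of index from b to - b introduces the conjugate. *)
Lemma char_poly_two_level_circulant :
  char_poly A = \prod_(a < n.+1) \prod_(b < n.+1)
    ('X - (\sum_k \sum_l e a k * (e b l)^* * f k l)%:P).
Proof.
rewrite (char_poly_similar_diag DFT2_unit mulmx_circulant_DFT) big_mxtens.
apply: eq_bigr => a _; rewrite (reindex_inj oppr_inj).
apply: eq_bigr => b _; rewrite mxE mxtens_indexK /=.
by under eq_bigr do under eq_bigr do rewrite pairingNl.
Qed.

End TwoLevelCirculant.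

Theorem theorem2 (R : realType) (n : nat) (g : 'cV[R[i]]_n.+1)
    (g_unit : vnorm g = 1) :
  (* (i) *)
  [/\ block_circulant (Gram g),
      forall k k' : 'I_n.+1, circulant (mxblk (Gram g) k k')
    & forall k k' l l' : 'I_n.+1,
        Gram g (mxtens_index (k, l)) (mxtens_index (k', l'))
          = inner_HS (Proj g k l) (Proj g k' l') /\
        inner_HS (Proj g k l) (Proj g k' l')
          = `|inner g (tfshift (k' - k) (l' - l) g)| ^+ 2]
  /\
  (* (ii) *)
  [/\ diagonalized_by (Gram g) (DFT R n *t DFT R n),
      exists lambda : 'I_n.+1 -> 'I_n.+1 -> R[i],
        char_poly (Gram g)
          = \prod_(a < n.+1) \prod_(b < n.+1) ('X - (lambda a b)%:P) /\
        forall a b : 'I_n.+1,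
          [/\ lambda a b
                = \sum_(k < n.+1) \sum_(l < n.+1)
                    omega R n.+1 ^ ((a * k)%N%:Z - (b * l)%N%:Z)
                    * `|inner g (tfshift k l g)| ^+ 2,
              lambda a b
                = n.+1%:R * `|\sum_(k < n.+1) g k 0 * (g (k + a) 0)^*
                                * omega R n.+1 ^+ (b * k)%N| ^+ 2
            & lambda a b = n.+1%:R * `|inner g (tfshift b a g)| ^+ 2]
    & forall mu : R[i],
        eigenvalue (Gram g) mu <-> exists i j, mu = n.+1%:R * Gram g i j].
Proof.
have GE := GramE g; split; split.
- exists (fun p => \matrix_(l, l') ambiguity2 g p (l' - l)) => k k'.
  by apply/matrixP => l l'; rewrite [LHS]mxE GE mxE.
- move=> k k'; exists (fun q => ambiguity2 g (k' - k) q) => l l'.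
  by rewrite mxE GE.
- by move=> k k' l l'; rewrite GE inner_HS_Proj.
- exact: diagonalized_by_unit (DFT2_unit R n) (mulmx_circulant_DFT GE).
- exists (fun a b => n.+1%:R * ambiguity2 g b a); split.
    rewrite (char_poly_two_level_circulant GE).
    by apply: eq_bigr => a _; apply: eq_bigr => b _; rewrite ambiguity2_self_dual.
  move=> a b; split=> //.
    rewrite -ambiguity2_self_dual; apply: eq_bigr => k _; apply: eq_bigr => l _.
    by rewrite omega_exprB.
  by rewrite -ambiguity2_self_dual ambiguity2_fourier.
move=> mu; rewrite eigenvalue_root_char (char_poly_two_level_circulant GE).
rewrite /root pair_bigA horner_prod /=; split.
  case/prodf_eq0 => -[a b] _ /=; rewrite hornerXsubC subr_eq0 => /eqP ->.
  (* The first row of the Gram matrix already contains every value. *)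
  exists (mxtens_index (0, 0)), (mxtens_index (b, a)).
  by rewrite GE !subr0 ambiguity2_self_dual.
case=> i [j]; case: (mxtens_indexP i) => k l; case: (mxtens_indexP j) => k' l' ->.
apply/prodf_eq0; exists (l' - l, k' - k) => //=.
by rewrite hornerXsubC GE ambiguity2_self_dual subrr.
Qed.
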